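(* For every integer $n\geq 1$, a subset $A\subset\mathbf{A}_{2n}$ is balanced if and only if the family of vector fields $\{f_U\}_{U\in A}$ is a moving finite unit tight frame (moving FUNTF) for the tangent bundle of $S^{2n-1}$.
   Context: The sphere is $S^{2n-1}=\{a\in\mathbb{R}^{2n}:\|a\|=1\}$, with the Riemannian metric given by the standard inner product $\langle\cdot,\cdot\rangle$ of $\mathbb{R}^{2n}$, and $T_aS^{2n-1}=\{b\in\mathbb{R}^{2n}:\langle a,b\rangle=0\}$ for $a\in S^{2n-1}$. A vector field on $S^{2n-1}$ is a continuous map $f$ with $f(a)\in T_aS^{2n-1}$ for all $a$. A finite family of vector fields $(f_i)_{i=1}^k$ on $S^{2n-1}$, with $k\geq 2n-1$, is a moving tight frame for the tangent bundle of $S^{2n-1}$ if for every $a\in S^{2n-1}$ there is a constant $C>0$ such that $x=\frac1C\sum_{i=1}^k\langle x,f_i(a)\rangle f_i(a)$ for all $x\in T_aS^{2n-1}$. It is a moving finite unit tight frame (moving FUNTF) if in addition $\|f_i(a)\|=1$ for all $i$ and all $a\in S^{2n-1}$. For $(\varepsilon_i)_{i=1}^{2n}\in\{-1,1\}^{2n}$ and $(k_i)_{i=1}^{2n}\in\{1,\dots,2n\}^{2n}$, let $U_{(\varepsilon_i,k_i)_{i=1}^{2n}}:\mathbb{R}^{2n}\to\mathbb{R}^{2n}$ be the linear operator $$U_{(\varepsilon_i,k_i)_{i=1}^{2n}}(a_1,\dots,a_{2n})=(\varepsilon_{k_1}a_{k_1},\dots,\varepsilon_{k_{2n}}a_{k_{2n}}).$$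 Let $$\mathbf{A}_{2n}=\left\{U_{(\varepsilon_i,k_i)_{i=1}^{2n}}:\ \varepsilon_i=-\varepsilon_{k_i}\text{ and }k_{k_i}=i\text{ for all }1\leq i\leq 2n\right\}.$$ For $U\in\mathbf{A}_{2n}$, the vector $U(a)$ is a unit vector in $T_aS^{2n-1}$ for every $a\in S^{2n-1}$, and $f_U$ denotes the unit vector field on $S^{2n-1}$ given by $f_U(a)=U(a)$. A subset $A\subset\mathbf{A}_{2n}$ is called balanced if for all $1\leq p,q\leq 2n$ with $p\neq q$: (i) $\#\{U_{(\varepsilon_i,k_i)_{i=1}^{2n}}\in A: k_p=q\}=\frac{\#A}{2n-1}$; and (ii) for all $1\leq r,s\leq 2n$ such that $p,q,r,s$ are all distinct, $$\#\{U_{(\varepsilon_i,k_i)_{i=1}^{2n}}\in A:\varepsilon_p\varepsilon_q=-1,\ \{k_r,k_s\}=\{p,q\}\}=\#\{U_{(\varepsilon_i,k_i)_{i=1}^{2n}}\in A:\varepsilon_p\varepsilon_q=1,\ \{k_r,k_s\}=\{p,q\}\}.$$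
   Formalization: The subset A is assumed nonempty: the empty set satisfies (i) and (ii) vacuously (0 = 0) and so is balanced, but the empty family has fewer than 2n-1 members and is not a moving FUNTF. *)

(* Defs.v *)
From HB Require Import structures.
From mathcomp Require Import all_boot all_order all_algebra finmap.
From mathcomp Require Import all_classical all_reals all_analysis.
Set Implicit Arguments.
Unset Strict Implicit.
Unset Printing Implicit Defensive.
Import Order.TTheory GRing.Theory Num.Theory.
Import numFieldNormedType.Exports.
Local Open Scope classical_set_scope.
Local Open Scope ring_scope.

(* The library's norm on row vectors is the sup norm (which induces the usual
   topology), so the Euclidean structure is introduced separately. *)
Definition inner (R : realType) (N : nat) (x y : 'rV[R]_N) : R :=
  \sum_(i < N) x 0 i * y 0 i.

Definition enorm (R : realType) (N : nat) (x : 'rV[R]_N) : R :=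
  Num.sqrt (inner x x).

(* sphere R n is S^(2n-1), seen inside R^(2n). *)
Definition sphere (R : realType) (n : nat) : set 'rV[R]_(2 * n) :=
  [set a | enorm a = 1].
Arguments sphere : clear implicits.

Definition tangent (R : realType) (n : nat) (a : 'rV[R]_(2 * n)) :
  set 'rV[R]_(2 * n) := [set b | inner a b = 0].

(* Vector fields are total functions on R^(2n); only their restriction to the
   sphere matters. *)
Definition vector_field (R : realType) (n : nat)
    (f : 'rV[R]_(2 * n) -> 'rV[R]_(2 * n)) : Prop :=
  {within sphere R n, continuous f} /\
  (forall a, sphere R n a -> tangent a (f a)).

Definition moving_tight_frame (R : realType) (n : nat) (I : finType)
    (f : I -> 'rV[R]_(2 * n) -> 'rV[R]_(2 * n)) : Prop :=
  [/\ (2 * n - 1 <= #|I|)%N,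
      forall i, vector_field (f i)
    & forall a, sphere R n a ->
        exists2 C : R, 0 < C & forall x, tangent a x ->
          x = C^-1 *: \sum_(i : I) inner x (f i a) *: f i a].

Definition moving_FUNTF (R : realType) (n : nat) (I : finType)
    (f : I -> 'rV[R]_(2 * n) -> 'rV[R]_(2 * n)) : Prop :=
  moving_tight_frame f /\
  (forall i a, sphere R n a -> enorm (f i a) = 1).

Definition sign_family (R : realType) (N : nat) (eps : 'I_N -> R) : Prop :=
  forall i, eps i = -1 \/ eps i = 1.

Definition signed_map (R : realType) (N : nat) (eps : 'I_N -> R)
    (k : 'I_N -> 'I_N) (a : 'rV[R]_N) : 'rV[R]_N :=
  \row_i (eps (k i) * a 0 (k i)).

Fact signed_map_is_linear (R : realType) (N : nat) (eps : 'I_N -> R)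
  (k : 'I_N -> 'I_N) : linear (signed_map eps k).
Proof. by move=> c u v; apply/rowP => i; rewrite !mxE mulrDr mulrCA. Qed.

HB.instance Definition _ (R : realType) (N : nat) (eps : 'I_N -> R)
    (k : 'I_N -> 'I_N) :=
  GRing.isLinear.Build R 'rV[R]_N 'rV[R]_N *:%R (signed_map eps k)
    (signed_map_is_linear eps k).

Definition signed_op (R : realType) (N : nat) (eps : 'I_N -> R)
    (k : 'I_N -> 'I_N) : 'End('rV[R]_N) := linfun (signed_map eps k).

Lemma signed_opE (R : realType) (N : nat) (eps : 'I_N -> R)
  (k : 'I_N -> 'I_N) (a : 'rV[R]_N) (i : 'I_N) :
  signed_op eps k a 0 i = eps (k i) * a 0 (k i).
Proof. by rewrite lfunE /= mxE. Qed.

Definition bfA (R : realType) (n : nat) : set 'End('rV[R]_(2 * n)) :=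
  [set U | exists (eps : 'I_(2 * n) -> R) (k : 'I_(2 * n) -> 'I_(2 * n)),
     [/\ sign_family eps, U = signed_op eps k
       & forall i, eps i = - eps (k i) /\ k (k i) = i]].
Arguments bfA : clear implicits.

Definition field_of (R : realType) (n : nat) (U : 'End('rV[R]_(2 * n))) :
  'rV[R]_(2 * n) -> 'rV[R]_(2 * n) := fun a => U a.

(* card_ops A P is the number of operators U_(eps, k) in A whose parameters
   satisfy P; it counts operators, not parameters. *)
Definition card_ops (R : realType) (n : nat) (A : {fset 'End('rV[R]_(2 * n))})
    (P : ('I_(2 * n) -> R) -> ('I_(2 * n) -> 'I_(2 * n)) -> Prop) : nat :=
  #|` [fset U in A | `[< exists (eps : 'I_(2 * n) -> R)
                                (k : 'I_(2 * n) -> 'I_(2 * n)),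
        [/\ sign_family eps, U = signed_op eps k & P eps k] >]]%fset |.

(* The first condition is an equality of rationals: its right-hand side is not
   rounded when 2n-1 does not divide #A. *)
Definition balanced (R : realType) (n : nat)
    (A : {fset 'End('rV[R]_(2 * n))}) : Prop :=
  forall p q : 'I_(2 * n), p != q ->
    (card_ops A (fun _ k => k p = q))%:R
      = (#|` A|)%:R / (2 * n%:R - 1) :> rat
    /\
    (forall r s : 'I_(2 * n), uniq [:: p; q; r; s] ->
       card_ops A (fun eps k =>
         eps p * eps q = -1 /\ [set k r; k s]%SET = [set p; q]%SET)
       = card_ops A (fun eps k =>
         eps p * eps q = 1 /\ [set k r; k s]%SET = [set p; q]%SET)).

(* Main.v *)
(* The frame operator of the fields at a unit vector a kills a, so tightness
   means that it equals C (I - a a^T); its trace forces C = #A / (2n-1).  The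
   (p, q) entry of the frame operator is a quadratic form in a whose
   coefficients are signed counts of operators.  Evaluating at e_q and at
   (e_r + e_s) / sqrt 2 reads off these coefficients: the diagonal entries give
   condition (i) and the off-diagonal ones condition (ii). *)
Require Import Defs.
From mathcomp Require Import all_boot all_order all_algebra finmap.
From mathcomp Require Import all_classical all_reals all_analysis.
From mathcomp Require Import ring lra.
Set Implicit Arguments.
Unset Strict Implicit.
Unset Printing Implicit Defensive.
Import Order.TTheory GRing.Theory Num.Theory.
Import numFieldNormedType.Exports.
Local Open Scope ring_scope.

(** * Euclidean geometry of row vectors and frames of a hyperplane *)

Lemma inner_deltaE (R : realType) (N : nat) (i : 'I_N) (x : 'rV[R]_N) :
  inner (delta_mx 0 i) x = x 0 i.
Proof.
rewrite /inner (bigD1 i) //= mxE !eqxx mul1r big1 ?addr0 // => j ji.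
by rewrite mxE (negPf ji) andbF mul0r.
Qed.

Lemma innerC (R : realType) (N : nat) (x y : 'rV[R]_N) :
  inner x y = inner y x.
Proof. by apply: eq_bigr => i _; rewrite mulrC. Qed.

Lemma innerDl (R : realType) (N : nat) (x y z : 'rV[R]_N) :
  inner (x + y) z = inner x z + inner y z.
Proof. by rewrite -big_split; apply: eq_bigr => i _; rewrite mxE mulrDl. Qed.

Lemma innerZl (R : realType) (N : nat) (c : R) (x y : 'rV[R]_N) :
  inner (c *: x) y = c * inner x y.
Proof. by rewrite /inner mulr_sumr; apply: eq_bigr => i _; rewrite mxE mulrA. Qed.

Lemma enorm_eq1 (R : realType) (N : nat) (x : 'rV[R]_N) :
  enorm x = 1 <-> inner x x = 1.
Proof.
have x0 : 0 <= inner x x by apply: sumr_ge0 => i _; rewrite -expr2 sqr_ge0.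
rewrite /enorm; split=> [x1|->]; last by rewrite sqrtr1.
by rewrite -(sqr_sqrtr x0) x1 expr1n.
Qed.

(** A linear map on row vectors is a finite sum of coordinate functions times constant vectors. *)
Lemma linear_rV_continuous (R : realType) (N : nat) (V : normedModType R)
  (f : {linear 'rV[R]_N -> V}) : continuous f.
Proof.
have -> : f = \sum_(i < N) (fun a : 'rV[R]_N => a 0 i *: f (delta_mx 0 i))
    :> ('rV[R]_N -> V).
  apply/funext => a; rewrite fct_sumE [in LHS](row_sum_delta a) linear_sum.
  by apply: eq_bigr => i _; rewrite linearZ.
apply: (big_ind (fun g : 'rV[R]_N -> V => continuous g)) => [|g h cg ch|i _] a.
- exact: cst_continuous.
- exact: (cvgD (cg a) (ch a)).
- apply: cvgZr_tmp; [exact: nbhs_filter | exact: (@coord_continuous R 1 N 0 i a)].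
Qed.

(* A tight frame of the hyperplane orthogonal to a unit vector a is one whose
   frame operator is C (I - a a^T); this is that identity, entry by entry. *)
Lemma tight_frameE (R : realType) (N : nat) (I : finType) (F : I -> 'rV[R]_N)
  (a : 'rV[R]_N) (C : R) : C != 0 -> inner a a = 1 ->
  (forall u, inner a (F u) = 0) ->
  (forall x, inner a x = 0 -> x = C^-1 *: \sum_u inner x (F u) *: F u) <->
  (forall p q, \sum_u F u 0 p * F u 0 q = C * ((p == q)%:R - a 0 p * a 0 q)).
Proof.
move=> C0 a1 aF; split=> [frame p q|gram x ax].
  (* [x] is the projection of the basis vector [e_p] to the hyperplane orthogonal to [a]. Each [F u]
     lies in that hyperplane, so its inner product with [x] is its coordinate [p]. *)
  pose x := delta_mx 0 p + (- a 0 p) *: a.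
  have ax : inner a x = 0.
    rewrite innerC innerDl innerZl inner_deltaE a1; ring.
  have /rowP/(_ q) := frame x ax.
  rewrite !mxE summxE eqxx /= (eq_sym q) => xq.
  have -> : (p == q)%:R - a 0 p * a 0 q = (p == q)%:R + - a 0 p * a 0 q by ring.
  rewrite xq mulrA divff // mul1r; apply: eq_bigr => u _.
  by rewrite mxE innerDl innerZl aF mulr0 addr0 inner_deltaE.
apply/rowP => q; rewrite mxE summxE.
under eq_bigr do rewrite mxE /inner mulr_suml.
rewrite exchange_big /=.
under eq_bigr => p _ do (under eq_bigr do rewrite -mulrA; rewrite -mulr_sumr gram).
have -> : \sum_p x 0 p * (C * ((p == q)%:R - a 0 p * a 0 q)) =
    C * (\sum_p x 0 p * (p == q)%:R - inner a x * a 0 q).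
  rewrite /inner mulr_suml -sumrB mulr_sumr; apply: eq_bigr => p _; ring.
rewrite ax mul0r subr0 mulrA mulVf // mul1r (bigD1 q) //= eqxx mulr1.
by rewrite big1 ?addr0 // => p /negPf ->; rewrite mulr0.
Qed.

(** Take traces: the frame operator has the sum of the squared norms, and [I - a a^T] has
    [N - 1]. *)
Lemma gram_trace (R : realType) (N : nat) (I : finType) (F : I -> 'rV[R]_N)
  (a : 'rV[R]_N) (C : R) : inner a a = 1 -> (forall u, inner (F u) (F u) = 1) ->
  (forall p q, \sum_u F u 0 p * F u 0 q = C * ((p == q)%:R - a 0 p * a 0 q)) ->
  #|I|%:R = C * (N%:R - 1).
Proof.
move=> a1 F1 gram.
have -> : #|I|%:R = \sum_(u : I) inner (F u) (F u).
  by under eq_bigr do rewrite F1; rewrite sumr_const.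
rewrite exchange_big /=; under eq_bigr do rewrite gram eqxx.
by rewrite -mulr_sumr sumrB sumr_const card_ord [X in _ - X]a1.
Qed.

(** * Signed involutions and their operators *)

(** Such a [k] is a perfect matching of the indices, and [eps] takes opposite signs at the two ends
    of each edge. *)
Definition signed_involution (R : realType) (N : nat) (eps : 'I_N -> R)
    (k : 'I_N -> 'I_N) : Prop :=
  sign_family eps /\ forall i, eps i = - eps (k i) /\ k (k i) = i.

Lemma signed_involution_neq (R : realType) (N : nat) (eps : 'I_N -> R)
  (k : 'I_N -> 'I_N) : signed_involution eps k -> forall i, k i != i.
Proof.
move=> [sgn inv] i; apply/eqP => ki; have [+ _] := inv i; rewrite ki.
by case: (sgn i) => ->; lra.
Qed.

(** The image of the basis vector at [k i] has coordinate [eps (k i)], nonzero, at [i]; this reads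
    off [k i] and the sign there. As [k] is onto, all signs are recovered. *)
Lemma signed_op_inj (R : realType) (N : nat) (eps eps' : 'I_N -> R)
  (k k' : 'I_N -> 'I_N) : signed_involution eps k ->
  signed_op eps k = signed_op eps' k' -> eps = eps' /\ k = k'.
Proof.
move=> [sgn inv] opE.
have main i : k i = k' i /\ eps (k i) = eps' (k i).
  have : signed_op eps k (delta_mx 0 (k i)) 0 i =
      signed_op eps' k' (delta_mx 0 (k i)) 0 i by rewrite opE.
  rewrite !signed_opE !mxE !eqxx /= mulr1 (eq_sym _ (k i)).
  case: eqP => [<-|_]; first by rewrite mulr1.
  by rewrite mulr0; case: (sgn (k i)) => ->; lra.
split; apply/funext => i; last by have [] := main i.
by have [_ <-] := inv i; have [] := main (k i).
Qed.

Section SignedInvolution.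
Variables (R : realType) (N : nat) (eps : 'I_N -> R) (k : 'I_N -> 'I_N).
Hypothesis epsk : signed_involution eps k.

Lemma signed_involution_inj : injective k.
Proof. by apply: (can_inj (g := k)) => i; have [_ /(_ i) []] := epsk. Qed.

(** Reindexing by [k] swaps the two ends of each edge, where the signs are opposite, so the sum
    equals its own negative. *)
Lemma signed_op_orthogonal (a : 'rV[R]_N) : inner a (signed_op eps k a) = 0.
Proof.
suff : inner a (signed_op eps k a) = - inner a (signed_op eps k a) by lra.
rewrite {1}/inner (reindex_inj signed_involution_inj) -sumrN.
apply: eq_bigr => i _; have [_ /(_ i) [epsi ki]] := epsk.
rewrite !signed_opE ki epsi; ring.
Qed.

Lemma signed_op_isometry (a : 'rV[R]_N) :
  inner (signed_op eps k a) (signed_op eps k a) = inner a a.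
Proof.
rewrite /inner [RHS](reindex_inj signed_involution_inj); apply: eq_bigr => i _.
by rewrite !signed_opE; case: (epsk.1 (k i)) => ->; ring.
Qed.

(** Passing from [eps (k p)] to [eps p] changes the sign; the two changes cancel. *)
Lemma signed_op_mul (a : 'rV[R]_N) (p q : 'I_N) :
  signed_op eps k a 0 p * signed_op eps k a 0 q =
  eps p * eps q * (a 0 (k p) * a 0 (k q)).
Proof.
rewrite !signed_opE; have [_ inv] := epsk.
by rewrite (inv p).1 (inv q).1; ring.
Qed.

(** A sign as a difference of indicators: this turns signed sums into differences of counts. *)
Lemma sign_mulE (p q : 'I_N) :
  eps p * eps q = (eps p * eps q == 1)%:R - (eps p * eps q == - 1)%:R.
Proof.
have N1 : (-1 == 1 :> R) = false by apply/eqP; lra.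
have N1' : (1 == -1 :> R) = false by apply/eqP; lra.
by case: (epsk.1 p) => ->; case: (epsk.1 q) => ->;
  rewrite ?(mulrN1, mulN1r, mulr1, mul1r, opprK) eqxx ?N1 ?N1' ?subr0 ?sub0r.
Qed.

(** As [k] is its own inverse, it sends [{r, s}] onto [{p, q}] exactly when it sends [{p, q}] onto
    [{r, s}], in one of two ways. *)
Lemma image_pairE (p q r s : 'I_N) : uniq [:: p; q; r; s] ->
  ([set k r; k s]%SET == [set p; q]%SET) =
  ((k p == r) && (k q == s)) || ((k p == s) && (k q == r)).
Proof.
rewrite /= !inE !negb_or => /and4P[/and3P[pq pr ps] /andP[qr qs] rs _].
have kE i j : (k i == j) = (i == k j).
  have [_ inv] := epsk.
  by apply/eqP/eqP => [<-|->]; rewrite (inv _).2.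
rewrite !kE; apply/eqP/orP => [setE|[]/andP[/eqP-> /eqP->] //]; last exact: finset.setUC.
have krs : k r != k s by rewrite (inj_eq signed_involution_inj).
have : k r \in [set p; q]%SET by rewrite -setE !inE eqxx.
have : k s \in [set p; q]%SET by rewrite -setE !inE eqxx orbT.
rewrite !inE => /orP[]/eqP ks /orP[]/eqP kr; move: krs; rewrite ks kr ?eqxx // => _.
- by right.
- by left.
Qed.

End SignedInvolution.

(** * The frame operator of a signed family as a quadratic form *)

Section SignedFamily.
Variables (R : realType) (N : nat) (I : finType).
Variables (eps : I -> 'I_N -> R) (k : I -> 'I_N -> 'I_N).
Hypothesis epsk : forall u, signed_involution (eps u) (k u).

Let F u (a : 'rV[R]_N) := signed_op (eps u) (k u) a.

Definition match_count (p q : 'I_N) : nat := #|[pred u | k u p == q]|.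

(* The coefficient of a_r a_s in the (p, q) entry of the frame operator at a. *)
Definition pairing (p q r s : 'I_N) : R :=
  \sum_u ((k u p == r) && (k u q == s))%:R * (eps u p * eps u q).

(** Each operator contributes one signed monomial, in the coordinates [k u p] and [k u q] of [a];
    the indicators in [pairing] collect equal monomials. *)
Lemma gram_pairing (a : 'rV[R]_N) (p q : 'I_N) :
  \sum_u F u a 0 p * F u a 0 q =
  \sum_r \sum_s pairing p q r s * (a 0 r * a 0 s).
Proof.
transitivity (\sum_u \sum_r \sum_s ((k u p == r) && (k u q == s))%:R *
    (eps u p * eps u q) * (a 0 r * a 0 s)).
  apply: eq_bigr => u _; rewrite signed_op_mul // pair_big /=.
  rewrite (bigD1 (k u p, k u q)) //= !eqxx mul1r big1 ?addr0 // => -[r s] /=.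
  rewrite xpair_eqE (eq_sym r) (eq_sym s) => /negPf ->; by rewrite !mul0r.
rewrite exchange_big; apply: eq_bigr => r _.
rewrite exchange_big; apply: eq_bigr => s _.
by rewrite mulr_suml.
Qed.

Lemma pairing_same (p r s : 'I_N) :
  pairing p p r s = (r == s)%:R * (match_count p r)%:R.
Proof.
rewrite /match_count -sum1_card natr_sum mulr_sumr [RHS]big_mkcond /=.
apply: eq_bigr => u _.
have -> : eps u p * eps u p = 1 by case: ((epsk u).1 p) => ->; ring.
rewrite inE mulr1; case: eqP => [->|] //=; by rewrite ?mulr1.
Qed.

Lemma pairing_diag (p q r : 'I_N) : p != q -> pairing p q r r = 0.
Proof.
move=> pq; apply: big1 => u _; case: andP => [[/eqP <- /eqP kE]|_]; last first.
  by rewrite mul0r.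
by move: pq; rewrite (signed_involution_inj (epsk u) kE) eqxx.
Qed.

Lemma pairing_eql (p q s : 'I_N) : pairing p q p s = 0.
Proof.
apply: big1 => u _.
by rewrite (negPf (signed_involution_neq (epsk u) _)) ?mul0r.
Qed.

Lemma pairing_eqr (p q r : 'I_N) : pairing p q r q = 0.
Proof.
apply: big1 => u _.
by rewrite (negPf (signed_involution_neq (epsk u) _)) ?andbF ?mul0r.
Qed.

(** If [k u p = q] then [k u q = p] and the signs at [p] and [q] are opposite, so each match
    contributes [-1]. *)
Lemma pairing_match (p q s : 'I_N) :
  pairing p q q s = - ((s == p)%:R * (match_count p q)%:R).
Proof.
rewrite /match_count -sum1_card natr_sum mulr_sumr -sumrN [RHS]big_mkcond /=.
apply: eq_bigr => u _; rewrite inE.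
case: eqP => [<-|_] /=; last by rewrite mul0r.
have [sgn /(_ p) [-> ->]] := epsk u.
by rewrite (eq_sym s); case: (sgn (k u p)) => ->; ring.
Qed.

Lemma pairing_matchr (p q r : 'I_N) : p != q ->
  pairing p q r p = - ((r == q)%:R * (match_count p q)%:R).
Proof.
move=> pq; rewrite /match_count -sum1_card natr_sum mulr_sumr -sumrN.
rewrite [RHS]big_mkcond /=.
apply: eq_bigr => u _; rewrite inE.
have [sgn inv] := epsk u.
have -> : (k u q == p) = (k u p == q).
  by apply/eqP/eqP => <-; rewrite (inv _).2.
case: (eqVneq (k u p) q) => [<-|_] /=; last by rewrite andbF mul0r.
rewrite andbT (inv p).1 (eq_sym r).
by case: (sgn (k u p)) => ->; ring.
Qed.

Lemma gram_balanced (C : R) :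
  (forall a, inner a a = 1 -> forall p q,
     \sum_u F u a 0 p * F u a 0 q = C * ((p == q)%:R - a 0 p * a 0 q)) <->
  (forall p q, p != q -> (match_count p q)%:R = C) /\
  (forall p q r s, uniq [:: p; q; r; s] ->
     pairing p q r s + pairing p q s r = 0).
Proof.
split=> [gram|[cnt alt] a a1 p q].
  split=> [p q pq|p q r s].
    (* At [e_q] the entry [(p, p)] reduces to the coefficient of [a_q ^ 2], which is
       [match_count p q]. *)
    have := gram (delta_mx 0 q).
    rewrite inner_deltaE mxE !eqxx => /(_ erefl p p).
    rewrite gram_pairing !mxE (negPf pq) /= eqxx mul0r subr0 mulr1 => <-.
    under eq_bigr do under eq_bigr do rewrite pairing_same.
    rewrite (bigD1 q) //= (bigD1 q) //= !mxE !eqxx !mulr1 mul1r.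
    rewrite !big1 ?addr0 // => i iq; rewrite ?big1 // => *;
      by rewrite !mxE (negPf iq) ?(mul0r, mulr0).
  rewrite /= !inE !negb_or => /and4P[/and3P[pq pr ps] /andP[qr qs] rs _].
  (* At [a = (e_r + e_s) / sqrt 2] the right-hand side vanishes, since [a] is zero at [p] and [q].
     On the left the square terms have coefficient 0 by [pairing_diag], leaving half the sum of the
     two mixed coefficients. *)
  pose c : R := (Num.sqrt 2)^-1.
  have c2 : c * c = 2^-1 by rewrite -expr2 exprVn sqr_sqrtr.
  pose a : 'rV[R]_N := c *: (delta_mx 0 r + delta_mx 0 s).
  have aE i : a 0 i = c * ((i == r)%:R + (i == s)%:R) by rewrite !mxE eqxx.
  have a1 : inner a a = 1.
    rewrite innerZl innerDl !inner_deltaE !aE !eqxx (negPf rs) (eq_sym s) (negPf rs).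
    by rewrite /= !addr0 !add0r !mulr1 mulrDr c2; lra.
  have := gram a a1 p q; rewrite gram_pairing (negPf pq) aE (negPf pr) (negPf ps).
  rewrite addr0 mulr0 mul0r subr0 mulr0.
  have sumE (G : 'I_N -> R) : \sum_i G i * a 0 i = c * (G r + G s).
    rewrite (bigD1 r) //= (bigD1 s) ?(eq_sym s) //= big1 => [|i /andP[ir is']].
      by rewrite !aE !eqxx (negPf rs) (eq_sym s) (negPf rs) /= !(addr0, add0r); ring.
    by rewrite aE (negPf ir) (negPf is') addr0 !mulr0.
  under eq_bigr do (under eq_bigr do rewrite mulrCA mulrC; rewrite -mulr_suml).
  rewrite sumE.
  rewrite !sumE !pairing_diag //; nra.
rewrite gram_pairing.
(* On the diagonal only squares occur: the entry is [C] times the sum of [a_r ^ 2] over [r != p],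
   that is [C * (1 - a_p ^ 2)]. *)
have [<-|pq] := eqVneq p q.
  under eq_bigr => r _.
    rewrite (bigD1 r) //= big1 => [|s /negPf sr]; last first.
      by rewrite pairing_same (eq_sym r) sr !mul0r.
    rewrite pairing_same eqxx mul1r addr0; over.
  move: (a1); rewrite /inner (bigD1 p) //= => /(canRL (addKr _)) sump.
  rewrite (bigD1 p) //=.
  have -> : match_count p p = 0%N.
    by apply: eq_card0 => u; rewrite !inE (negPf (signed_involution_neq (epsk u) _)).
  rewrite mul0r add0r.
  under eq_bigr => r rp do rewrite cnt 1?eq_sym //.
  by rewrite -mulr_sumr sump addrC.
set S := (LHS).
(* A quadratic form depends only on the symmetric part of its coefficients, and the second
   hypothesis controls only that part; hence the doubling. *)
have S2 : S + S = \sum_r \sum_s (pairing p q r s + pairing p q s r) * (a 0 r * a 0 s).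
  rewrite {1}/S exchange_big -big_split /=; apply: eq_bigr => r _.
  rewrite -big_split /=; apply: eq_bigr => s _; ring.
(* The only surviving monomial is [a_p a_q], coming from operators that match [p] with [q]. Indices
   [r], [s] distinct from each other and from [p], [q] are the case covered by [alt]. *)
have symE r s : pairing p q r s + pairing p q s r =
    - C * ((r == q)%:R * (s == p)%:R + (r == p)%:R * (s == q)%:R).
  have [->|rp] := eqVneq r p.
    by rewrite pairing_eql pairing_matchr // cnt // (negPf pq) ?mulr0n ?mulr1n; ring.
  have [->|rq] := eqVneq r q.
    by rewrite pairing_eqr pairing_match cnt // ?mulr0n ?mulr1n; ring.
  have [->|sp] := eqVneq s p.
    by rewrite pairing_eql pairing_matchr // (negPf rq) ?mulr0n ?mulr1n; ring.
  have [->|sq] := eqVneq s q.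
    by rewrite pairing_eqr pairing_match (negPf rp) ?mulr0n ?mulr1n; ring.
  have [->|rs] := eqVneq r s; first by rewrite pairing_diag // ?mulr0n; ring.
  rewrite alt /=; first by rewrite ?mulr0n; ring.
  by rewrite !inE !negb_or pq rs (eq_sym p) rp (eq_sym p) sp (eq_sym q) rq (eq_sym q) sq.
suff : S + S = - C * (a 0 p * a 0 q) + - C * (a 0 p * a 0 q) by rewrite mulr0n; lra.
rewrite S2.
have pick (G : 'I_N -> 'I_N -> R) x y :
    \sum_r \sum_s (r == x)%:R * (s == y)%:R * G r s = G x y.
  rewrite (bigD1 x) //= (bigD1 y) //= !eqxx !mul1r !big1 ?addr0 // => i ix.
    by rewrite big1 // => j _; rewrite (negPf ix) !mul0r.
  by rewrite (negPf ix) mulr0 mul0r.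
transitivity (\sum_r \sum_s (r == q)%:R * (s == p)%:R * (- C * (a 0 r * a 0 s)) +
    \sum_r \sum_s (r == p)%:R * (s == q)%:R * (- C * (a 0 r * a 0 s))).
  rewrite -big_split; apply: eq_bigr => r _; rewrite -big_split.
  by apply: eq_bigr => s _; rewrite symE /=; ring.
by rewrite !pick; ring.
Qed.

(** As [r != s], the two ways of sending [{p, q}] onto [{r, s}] exclude each other, so their
    indicators add up to that of the union; [sign_mulE] then splits by sign. *)
Lemma pairing_symE (p q r s : 'I_N) : uniq [:: p; q; r; s] ->
  pairing p q r s + pairing p q s r =
  #|[pred u | (eps u p * eps u q == 1) &&
      ([set k u r; k u s]%SET == [set p; q]%SET)]|%:R -
  #|[pred u | (eps u p * eps u q == - 1) &&
      ([set k u r; k u s]%SET == [set p; q]%SET)]|%:R.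
Proof.
move=> pqrs; rewrite -!sum1_card !natr_sum.
rewrite [X in _ = X - _]big_mkcond [X in _ = _ - X]big_mkcond -sumrB -big_split.
apply: eq_bigr => u _; rewrite !inE /= (image_pairE (epsk u)) // -mulrDl.
rewrite [in LHS](sign_mulE (epsk u)).
have rs : r != s by move: pqrs; rewrite /= !inE !negb_or => /and4P[].
have -> (b b' : bool) : ~~ (b && b') -> b%:R + b'%:R = (b || b')%:R :> R.
  by case: b; case: b' => //= _; rewrite ?addr0 ?add0r.
  by case: (_ || _); case: (_ == 1); case: (_ == -1);
    rewrite /= ?mulr0n ?mulr1n; ring.
by apply/negP => /andP[/andP[/eqP -> _] /andP[/eqP /eqP]]; rewrite (negPf rs).
Qed.

End SignedFamily.

(** * Operator counts and the balance conditions *)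

(** By [signed_op_inj] the parameters quantified in [card_ops] can only be the chosen ones. *)
Lemma card_opsE (R : realType) (n : nat) (A : {fset 'End('rV[R]_(2 * n))})
  (eps : A -> 'I_(2 * n) -> R) (k : A -> 'I_(2 * n) -> 'I_(2 * n))
  (P : ('I_(2 * n) -> R) -> ('I_(2 * n) -> 'I_(2 * n)) -> Prop) :
  (forall U, signed_involution (eps U) (k U)) ->
  (forall U, val U = signed_op (eps U) (k U)) ->
  card_ops A P = #|[pred U : A | `[< P (eps U) (k U) >]]|.
Proof.
move=> epsk opE; rewrite /card_ops card_fset_sum1 -big_fset_condE /=.
rewrite big_seq_fsetE -sum1_card; apply: eq_bigl => U; rewrite inE.
apply/asboolP/asboolP => [[eps' [k' [_ UE]]]|PU].
  by have [-> ->] := signed_op_inj (epsk U) (etrans (esym (opE U)) UE).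
by exists (eps U), (k U); split=> //; case: (epsk U).
Qed.

(** Clearing the denominator leaves an equation in natural numbers, the same for every field; it
    carries condition (i) from [rat] to [R]. *)
Lemma natr_ratioE (K : numFieldType) (n c m : nat) : (0 < n)%N ->
  (c%:R = m%:R / (2 * n%:R - 1) :> K) <-> (c * (2 * n - 1))%N = m.
Proof.
move=> n0; have -> : 2 * n%:R - 1 = (2 * n - 1)%N%:R :> K.
  by rewrite natrB ?natrM // muln_gt0.
have d0 : (2 * n - 1)%N%:R != 0 :> K by rewrite pnatr_eq0 -lt0n subn_gt0 leq_pmulr.
split=> [cE|<-]; last by rewrite natrM mulfK.
by apply/eqP; rewrite -(eqr_nat K) natrM cE divfK.
Qed.

Lemma balancedE (R : realType) (n : nat) (A : {fset 'End('rV[R]_(2 * n))})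
  (eps : A -> 'I_(2 * n) -> R) (k : A -> 'I_(2 * n) -> 'I_(2 * n)) :
  (forall U, signed_involution (eps U) (k U)) ->
  (forall U, val U = signed_op (eps U) (k U)) -> (0 < n)%N ->
  balanced A <->
  (forall p q, p != q -> (match_count k p q)%:R = #|` A|%:R / (2 * n%:R - 1) :> R) /\
  (forall p q r s, uniq [:: p; q; r; s] ->
     pairing eps k p q r s + pairing eps k p q s r = 0).
Proof.
move=> epsk opE n0.
have cntE p q : card_ops A (fun _ k => k p = q) = match_count k p q.
  by rewrite (card_opsE _ epsk opE); apply: eq_card => U; rewrite !inE; apply/asboolP/eqP.
have altE e p q r s : card_ops A (fun eps k =>
      eps p * eps q = e /\ [set k r; k s]%SET = [set p; q]%SET) =
    #|[pred U | (eps U p * eps U q == e) &&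
      ([set k U r; k U s]%SET == [set p; q]%SET)]|.
  rewrite (card_opsE _ epsk opE); apply: eq_card => U; rewrite !inE.
  by apply/asboolP/andP => -[/eqP -> /eqP ->].
have pairE p q r s : uniq [:: p; q; r; s] ->
    (pairing eps k p q r s + pairing eps k p q s r = 0) <->
    card_ops A (fun eps k =>
      eps p * eps q = -1 /\ [set k r; k s]%SET = [set p; q]%SET)
    = card_ops A (fun eps k =>
      eps p * eps q = 1 /\ [set k r; k s]%SET = [set p; q]%SET).
  move=> pqrs; rewrite pairing_symE // !altE; split=> [/eqP|->]; last first.
    by rewrite subrr.
  by rewrite subr_eq0 eqr_nat => /eqP.
split=> [bal|[cnt alt] p q pq].
  split=> [p q pq|p q r s pqrs].
    by apply/natr_ratioE => //; rewrite -cntE; apply/(natr_ratioE rat) => //; case: (bal p q pq).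
  have pq : p != q by move: pqrs; rewrite /= !inE !negb_or => /and4P[/and3P[]].
  by apply/pairE => //; have [_ /(_ r s pqrs)] := bal p q pq.
split; first by rewrite cntE; apply/natr_ratioE/(natr_ratioE R) => //; exact: cnt.
by move=> r s pqrs; apply/pairE => //; exact: alt.
Qed.

Theorem theorem8 (R : realType) (n : nat) (hn : (1 <= n)%N)
  (A : {fset 'End('rV[R]_(2 * n))})
  (hA : forall U : 'End('rV[R]_(2 * n)), U \in A -> bfA R n U)
  (hA0 : A <> fset0) :
  balanced A <-> moving_FUNTF (fun U : A => field_of (val U)).
Proof.
have /choice[ek ekP] (U : A) : exists ek : ('I_(2 * n) -> R) * ('I_(2 * n) -> 'I_(2 * n)),
    signed_involution ek.1 ek.2 /\ val U = signed_op ek.1 ek.2.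
  by have [eps [k [sgn UE inv]]] := hA (val U) (valP U); exists (eps, k).
pose eps U := (ek U).1; pose k U := (ek U).2.
have epsk U : signed_involution (eps U) (k U) by have [] := ekP U.
have opE U : val U = signed_op (eps U) (k U) by have [] := ekP U.
have d0 : 0 < 2 * n%:R - 1 :> R.
  by have : 1 <= n%:R :> R; [rewrite ler1n | lra].
(* The empty set meets both balance conditions but has too few fields for a frame; non-emptiness
   makes [C] positive. *)
have A0 : (0 < #|` A|)%N by rewrite cardfs_gt0; apply/eqP.
set C : R := #|` A|%:R / (2 * n%:R - 1).
have C0 : 0 < C by rewrite divr_gt0 // ltr0n.
have -> : (fun U : A => @field_of R n (val U)) =
    (fun U a => signed_op (eps U) (k U) a).
  by apply/funext => U; apply/funext => a; rewrite /field_of opE.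
rewrite (balancedE epsk opE hn) -(gram_balanced epsk).
split=> [gram|[[_ _ tight] _] a a1].
  split; last by move=> U a /enorm_eq1 a1; apply/enorm_eq1; rewrite signed_op_isometry.
  split.
  (* The size bound: [#A] is [2n - 1] times the number of operators matching indices 0 and 1, which
     is nonzero because [A] is not empty. *)
  - have /(gram_balanced epsk)[cnt _] := gram.
    pose p : 'I_(2 * n) := Ordinal (leq_trans (isT : (0 < 2)%N) (leq_pmulr 2 hn)).
    pose q : 'I_(2 * n) := Ordinal (leq_pmulr 2 hn).
    have /natr_ratioE-/(_ hn) cE := cnt p q isT.
    by rewrite -cardfE -cE leq_pmull // lt0n; apply: contraTneq A0 => c0; rewrite -cE c0.
  - move=> U; split=> [|a _]; last exact: signed_op_orthogonal.
    by apply: continuous_subspaceT; exact: linear_rV_continuous.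
  - move=> a /enorm_eq1 a1; exists C => // x ax.
    apply: (iffRL (tight_frameE _ a1 _)) ax; [exact: lt0r_neq0 | | exact: gram].
    by move=> U; exact: signed_op_orthogonal.
(* The constant [C'] could depend on [a]; the trace identity forces it to equal [C]. *)
have [C' C'0 frame] := tight a (iffRL (enorm_eq1 a) a1).
have gram := iffLR (tight_frameE (lt0r_neq0 C'0) a1
  (fun U => signed_op_orthogonal (epsk U) a)) frame.
have := gram_trace a1 (fun U => etrans (signed_op_isometry (epsk U) a) a1) gram.
by rewrite -cardfE natrM /C => ->; rewrite mulfK ?lt0r_neq0.
Qed.
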